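(* For all integers $n\ge 1$, $k\ge 0$ and $r,s$ with $0\le r<s\le n$, $$M_{r,s}^{n,k}=\sum_{i=0}^{k}\binom{k}{i}\left[\binom{n-k+i-1}{s-1}\binom{n-i-1}{n-r-1}-\binom{n-k+i-1}{s}\binom{n-i-1}{n-r}\right].$$
   Context: A lattice path of length $n$ here is a path in the plane starting at the origin $(0,0)$ and consisting of $n$ unit steps, each either E $=(1,0)$ or N $=(0,1)$. For integers $n\ge 1$, $k\ge 0$, $0\le r,s\le n$, let $M_{r,s}^{n,k}$ be the number of ordered pairs of lattice paths of length $n$ such that the first path ends at $(r,n-r)$, the second path ends at $(s,n-s)$, and the two paths intersect exactly $k$ times, where intersections at the origin and at the endpoints of the paths are not counted; that is, there are exactly $k$ indices $m$ with $1\le m\le n-1$ such that the two paths are at the same lattice point after $m$ steps. Binomial coefficients $\binom{a}{b}$ are $0$ unless $0\le b\le a$ (in particular they are $0$ when $a<0$). *)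

(* Defs.v *)
From mathcomp Require Import all_boot all_order all_algebra.

Set Implicit Arguments.
Unset Strict Implicit.
Unset Printing Implicit Defensive.

(* A lattice path of length n is encoded by its n steps: true is the step     *)
(* E = (1,0) and false is the step N = (0,1); the path starts at (0,0).       *)
Notation lattice_path n := (n.-tuple bool).

Definition point_after (n : nat) (p : lattice_path n) (m : nat) : nat * nat :=
  let steps := take m (val p) in (count id steps, count negb steps).

Definition endpoint (n : nat) (p : lattice_path n) : nat * nat :=
  point_after p n.

(* The index m ranges over 1 <= m <= n - 1: the origin (m = 0) and the        *)
(* endpoints (m = n) are not counted.                                         *)
Definition intersections (n : nat) (p q : lattice_path n) : nat :=
  #|[set m : 'I_n | (0 < m) && (point_after p m == point_after q m)]|.

(* Intended for r, s <= n, where n - r and n - s are not truncated.           *)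
Definition num_path_pairs (n k r s : nat) : nat :=
  #|[set pq : lattice_path n * lattice_path n |
      [&& endpoint pq.1 == (r, n - r),
          endpoint pq.2 == (s, n - s)
        & intersections pq.1 pq.2 == k]]|.

(* Binomial coefficient with integer arguments, 0 unless 0 <= b <= a. The     *)
(* path-pair formula has negative upper arguments when k >= n, and truncated  *)
(* natural subtraction would then wrongly give 'C(0, 0) = 1.                  *)
Definition binz (a b : int) : int :=
  if ((0 <= b) && (b <= a))%R then Posz 'C(`|a|, `|b|) else 0%R.

(* Main.v *)
(* Let A n k r s count the pairs ending after r and s steps E that meet k     *)
(* times at indices 1..n, so that A agrees with M off the diagonal r = s.       *)
(* Removing the last steps gives a recurrence for A. For k < n and r <= s, it   *)
(* is solved by the coefficient of x^r y^s in                                   *)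
(*   (y - x) ((1 + x)(1 + y))^(n-1-k) (1 + 2x + xy)^k:                          *)
(* off the diagonal a step multiplies by (1 + x)(1 + y); on the diagonal,       *)
(* where k increases, the symmetry A n k r s = A n k s r turns this factor into *)
(* 1 + 2x + xy. For k = 0 the polynomial is antisymmetric, so its diagonal      *)
(* vanishes as it should. Expanding 1 + 2x + xy = (1 + x) + x (1 + y) by the    *)
(* binomial theorem yields the formula.                                         *)

Require Import Defs.
From mathcomp Require Import all_boot all_order all_algebra.
From mathcomp Require Import zify ring.

Import GRing.Theory.

Local Open Scope ring_scope.

Section Counting.
Local Open Scope nat_scope.

(** Counting the endpoint as a meeting makes [path_pairs] obey a single recurrence in the length,
    [path_pairsS]. Two boundaries, k = 0 on the diagonal and k = n - 1 off it, then determine all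
    values with k < n and r <= s. [path_pairs_genpoly] matches them with [genpoly], and
    [coef2_genpoly] extracts the coefficients. For k >= n both sides of the formula vanish. *)

Definition meetings (n : nat) (p q : seq bool) : nat :=
  \sum_(i < n) (count id (take i.+1 p) == count id (take i.+1 q)).

Definition path_pairs (n k r s : nat) : nat :=
  \sum_(p : n.-tuple bool) \sum_(q : n.-tuple bool)
    [&& count id p == r, count id q == s & meetings n p q == k].

Lemma path_pairsC n k r s : path_pairs n k r s = path_pairs n k s r.
Proof.
rewrite /path_pairs exchange_big /=; apply: eq_bigr => q _; apply: eq_bigr => p _.
suff -> : meetings n p q = meetings n q p by rewrite andbCA.
by apply: eq_bigr => i _; rewrite eq_sym.
Qed.

Lemma meetings_rcons n (p q : n.-tuple bool) b c :
  meetings n.+1 (rcons p b) (rcons q c) =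
  meetings n p q + (count id p + b == count id q + c).
Proof.
rewrite /meetings big_ord_recr /=; congr (_ + _).
  apply: eq_bigr => i _.
  by rewrite -!cats1 !takel_cat ?size_tuple.
by rewrite !take_oversize ?size_rcons ?size_tuple // -!cats1 !count_cat /= !addn0.
Qed.

Lemma big_tuple_rcons n (F : n.+1.-tuple bool -> nat) :
  \sum_(t : n.+1.-tuple bool) F t =
  \sum_(p : n.-tuple bool) (F [tuple of rcons p true] + F [tuple of rcons p false]).
Proof.
pose f (u : n.-tuple bool * bool) := [tuple of rcons u.1 u.2].
have f_inj : injective f.
  move=> [p b] [q c] /(congr1 val) /= /rcons_inj [pq ->].
  by congr pair; apply: val_inj.
have f_bij : bijective f.
  by apply: inj_card_bij f_inj _; rewrite card_prod !card_tuple card_bool expnSr.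
rewrite (reindex f) /=; last exact: onW_bij.
rewrite -(pair_bigA _ (fun p b => F (f (p, b)))) /=.
by apply: eq_bigr => p _; rewrite big_bool.
Qed.

(** Split on the two last steps. Ending on the diagonal uses up one meeting, hence the guard and the
    shift of k by [(r == s)]. *)
Lemma path_pairsS n k r s :
  path_pairs n.+1 k r s =
  if (r == s) <= k then
    let A := path_pairs n (k - (r == s)) in
    A r s + (if 0 < r then A r.-1 s else 0) + (if 0 < s then A r s.-1 else 0)
    + (if (0 < r) && (0 < s) then A r.-1 s.-1 else 0)
  else 0.
Proof.
rewrite /path_pairs big_tuple_rcons.
under eq_bigr => p _ do rewrite !big_tuple_rcons -big_split.
have iflift (b : bool) (F : n.-tuple bool -> n.-tuple bool -> nat) :
    (if b then \sum_p \sum_q F p q else 0) = \sum_p \sum_q (if b then F p q else 0).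
  by case: b => //; rewrite big1 // => p _; rewrite big1.
have step (p q : n.-tuple bool) (b c : bool) :
    [&& count id p + (b + 0) == r, count id q + (c + 0) == s
      & meetings n p q + (count id p + (b + 0) == count id q + (c + 0)) == k]
    = [&& (r == s) <= k, b <= r, c <= s, count id p == r - b, count id q == s - c
      & meetings n p q == k - (r == s)].
  move: (count id p) (count id q) (meetings n p q) => a1 a2 m; rewrite !addn0.
  have -> : (a1 + b == r) = (b <= r) && (a1 == r - b) by lia.
  have -> : (a2 + c == s) = (c <= s) && (a2 == s - c) by lia.
  case: (boolP (b <= r)) => le_br; last by rewrite andbF.
  case: (boolP (c <= s)) => le_cs; last by rewrite !andbF.
  case: eqP => [->|_]; last by rewrite !andbF.
  case: eqP => [->|_]; last by rewrite !andbF.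
  by rewrite /= !subnK //; lia.
case: (leqP (r == s) k) => [le_k|lt_k]; last first.
  rewrite big1 // => p _; rewrite big1 //= => q _.
  by rewrite !meetings_rcons -!cats1 !count_cat /=
     (step p q true true) (step p q true false) (step p q false true)
     (step p q false false) leqNgt lt_k.
rewrite !iflift -!big_split /=; apply: eq_bigr => p _.
rewrite -!big_split /=; apply: eq_bigr => q _.
rewrite !meetings_rcons -!cats1 !count_cat /=
   (step p q true true) (step p q true false) (step p q false true)
   (step p q false false) le_k /= !subn0 !subn1.
by case: (0 < r); case: (0 < s) => /=; lia.
Qed.

(** There are only n indices to meet at, and meeting at all of them forces the two paths to
    coincide. *)
Lemma path_pairs_small n k r s :
  n <= k -> path_pairs n k r s = if (r == s) && (k == n) then 'C(n, r) else 0.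
Proof.
elim: n k r s => [|n IHn] k r s le_nk.
  have all_nil : xpredT =1 pred1 ([tuple] : 0.-tuple bool).
    by move=> t; rewrite (tuple0 t) /= eqxx.
  rewrite /path_pairs !(big_pred1 _ all_nil) /meetings big_ord0 /= bin0n.
  by case: r => [|r]; case: s => [|s] //=; case: k le_nk => // k; rewrite if_same.
rewrite path_pairsS; cbv zeta; case: k le_nk => // k le_nk.
rewrite !IHn; try lia.
case: eqVneq => [<-|neq_rs] /=.
  rewrite subSS subn0 eqSS; case: r => [|r] /=; first by rewrite !bin0 !addn0.
  rewrite eqxx [r.+1 == r]eq_sym [r == r.+1]ltn_eqF //= binS.
  by case: (k == n); rewrite ?addn0.
have -> : (k.+1 - 0 == n) = false by lia.
by rewrite !andbF !if_same.
Qed.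

(** The paths share their first n steps and must part at the last one, N for the first path and E
    for the second. *)
Lemma path_pairs_max_offdiag n r s :
  r < s -> path_pairs n.+1 n r s = if s == r.+1 then 'C(n, r) else 0.
Proof.
move=> lt_rs; rewrite path_pairsS (ltn_eqF lt_rs) /= subn0 !path_pairs_small //.
rewrite (ltn_eqF lt_rs) eqxx !andbT /=.
case: s lt_rs => [|s] //= lt_rs; rewrite eqSS [s == r]eq_sym.
case: r lt_rs => [|r] lt_rs; first by rewrite /= !addn0.
by rewrite /= [r == s.+1]ltn_eqF ?[r == s]ltn_eqF ?addn0 //; lia.
Qed.

Lemma count_negb (u : seq bool) : count negb u = size u - count id u.
Proof. by rewrite -(count_predC id u) addKn. Qed.

(** Prefixes of equal length end at the same point once their E counts agree; the extra term is the
    endpoint, which only [meetings] counts. *)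
Lemma intersections_meetings n (p q : n.-tuple bool) :
  0 < n -> intersections p q + (count id p == count id q) = meetings n p q.
Proof.
case: n p q => // n p q _.
rewrite /intersections -sum1_card big_mkcond big_ord_recl /= inE /= add0n.
rewrite /meetings big_ord_recr /= !take_oversize ?size_tuple //; congr (_ + _).
apply: eq_bigr => i _; rewrite inE /point_after /= xpair_eqE.
rewrite !count_negb !size_takel ?size_tuple ?ltnS 1?ltnW //.
by case: eqP => // ->; rewrite eqxx.
Qed.

Lemma num_path_pairs_offdiag n k r s :
  r < s <= n -> num_path_pairs n k r s = path_pairs n k r s.
Proof.
move=> /andP[lt_rs le_sn]; rewrite /num_path_pairs /path_pairs.
rewrite pair_bigA -sum1_card big_mkcond /=; apply: eq_bigr => -[p q] _ /=.
rewrite inE /endpoint /point_after /= !take_oversize ?size_tuple // !xpair_eqE.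
have endE (t : n.-tuple bool) j :
    (count id t == j) && (count negb t == n - j) = (count id t == j).
  by rewrite count_negb size_tuple; case: eqP => //= ->; rewrite eqxx.
rewrite !endE -intersections_meetings; last by lia.
case: eqP => //= ->; case: eqP => //= ->.
by rewrite (ltn_eqF lt_rs) addn0; case: (_ == _).
Qed.

End Counting.

(* [x] is the constant ['X%:P] and [y] is ['X], so the coefficient of x^r y^s  *)
(* is [_`_s`_r].                                                               *)
Definition genpoly (j k : nat) : {poly {poly int}} :=
  ('X - 'X%:P) * ((1 + 'X%:P) * (1 + 'X)) ^+ j * (1 + 'X%:P *+ 2 + 'X%:P * 'X) ^+ k.

Lemma coef_add1X_exp (R : nzRingType) (j r : nat) :
  ((1 + 'X : {poly R}) ^+ j)`_r = ('C(j, r))%:R.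
Proof.
elim: j r => [|j IHj] r; first by rewrite expr0 coef1 bin0n.
rewrite exprS mulrDl mul1r coefD coefXM !IHj.
by case: r => [|r] /=; rewrite ?bin0 ?addr0 // binS natrD.
Qed.

Lemma coef2_prod_exp (a b r s : nat) :
  ((1 + 'X%:P) ^+ a * (1 + 'X) ^+ b : {poly {poly int}})`_s`_r
  = ('C(a, r) * 'C(b, s))%:Z.
Proof.
rewrite -polyC1 -polyCD -rmorphXn /= coefCM coef_add1X_exp mulr_natr coefMn.
by rewrite coef_add1X_exp -mulrnA natz.
Qed.

(** In every monomial the degree in y is at most the degree in x, with equality only for products of
    1 and xy; so only (1 + xy)^k contributes. *)
Lemma coef2_diag_exp (k r s : nat) : (r <= s)%N ->
  ((1 + 'X%:P *+ 2 + 'X%:P * 'X) ^+ k : {poly {poly int}})`_s`_r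
  = if r == s then ('C(k, r))%:Z else 0.
Proof.
elim: k r s => [|k IHk] r s le_rs.
  rewrite expr0 coef1 bin0n; case: s le_rs => [|s] le_rs /=.
    by case: r le_rs => // _; rewrite coef1.
  by rewrite coef0; case: r le_rs => // r _; rewrite if_same.
rewrite exprS !mulrDl mul1r -mulrA !coefD !coefCM !coefXM.
case: r le_rs => [|r]; case: s => [|s] // le_rs.
- by rewrite IHk // !bin0 coef0.
- by rewrite IHk //= !addr0.
rewrite !IHk /=; [|lia..].
rewrite [r == s.+1]ltn_eqF // !addr0 eqSS binS.
by case: eqP => // _; rewrite -PoszD.
Qed.

Lemma coef2_genpoly_k0 (j r : nat) : (genpoly j 0)`_r`_r = 0.
Proof.
rewrite /genpoly expr0 mulr1 exprMn mulrBl !coefB coefXM coefCM coefXM.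
case: r => [|r] /=; first by rewrite coef0 subrr.
by rewrite !coef2_prod_exp mulnC subrr.
Qed.

Lemma coef2_genpoly_j0 (k r s : nat) : (r < s)%N ->
  (genpoly 0 k)`_s`_r = if s == r.+1 then ('C(k, r))%:Z else 0.
Proof.
rewrite /genpoly expr0 mulr1 mulrBl !coefB coefXM coefCM coefXM.
case: s => // s le_rs; rewrite /= coef2_diag_exp // eqSS [s == r]eq_sym.
case: r le_rs => [|r] lt_rs /=; first by rewrite subr0.
by rewrite coef2_diag_exp ?[r == s.+1]ltn_eqF ?subr0 //; lia.
Qed.

Lemma path_pairs_genpoly (n k r s : nat) : (k <= n)%N -> (r <= s)%N ->
  (path_pairs n.+1 k r s)%:Z = (genpoly (n - k) k)`_s`_r.
Proof.
have pred_meet m r' s' : (r' < s')%N ->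
    (path_pairs m.+1 m r' s')%:Z = (genpoly (m - m) m)`_s'`_r'.
  by move=> lt_rs; rewrite subnn coef2_genpoly_j0 // path_pairs_max_offdiag //; case: eqP.
have diag0 m r' : (path_pairs m.+1 0 r' r')%:Z = (genpoly m 0)`_r'`_r'.
  by rewrite coef2_genpoly_k0 path_pairsS eqxx.
elim: n k r s => [|n IHn] k r s le_kn; rewrite leq_eqVlt => /predU1P[<-|lt_rs].
- by case: k le_kn => // _; exact: diag0.
- by case: k le_kn => // _; exact: pred_meet.
- case: k le_kn => [|k] le_kn; first by rewrite subn0 diag0.
  rewrite path_pairsS eqxx /= !subSS subn0.
  have -> : genpoly (n - k) k.+1
    = genpoly (n - k) k + 'X%:P * genpoly (n - k) k + 'X%:P * genpoly (n - k) k
      + 'X%:P * ('X * genpoly (n - k) k) by rewrite /genpoly exprS; ring.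
  rewrite !coefD !coefCM !coefXM.
  case: r => [|r] /=; first by rewrite !addr0 !addn0 IHn.
  (* The predecessor below the diagonal is reflected to the side where the induction hypothesis
     applies, which turns x + y into 2x. *)
  by rewrite [path_pairs _ _ r.+1 r]path_pairsC !PoszD !IHn.
- move: le_kn; rewrite leq_eqVlt => /predU1P[->|]; first exact: pred_meet.
  rewrite ltnS => le_kn; rewrite path_pairsS (ltn_eqF lt_rs) /= subn0 subSn //.
  have -> : genpoly (n - k).+1 k
    = genpoly (n - k) k + 'X%:P * genpoly (n - k) k + 'X * genpoly (n - k) k
    + 'X%:P * ('X * genpoly (n - k) k) by rewrite /genpoly exprS; ring.
  rewrite !coefD !coefCM !coefXM.
  (* As r < s, lowering s by one keeps r <= s, so the induction hypothesis covers all four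
     predecessors. *)
  case: s lt_rs => [|s] // lt_rs.
  case: r lt_rs => [|r] lt_rs; first by rewrite /= !addr0 !addn0 PoszD !IHn.
  by rewrite /= !PoszD !IHn //; lia.
Qed.

Lemma coef2_genpoly (j k r s : nat) :
  (genpoly j k)`_s.+1`_r =
  \sum_(i < k.+1) ('C(k, i))%:Z *
    ((if (i <= r)%N then ('C(j + (k - i), r - i) * 'C(j + i, s))%:Z else 0)
     - (if (i < r)%N then ('C(j + (k - i), r - i.+1) * 'C(j + i, s.+1))%:Z else 0)).
Proof.
rewrite /genpoly.
have -> : 1 + 'X%:P *+ 2 + 'X%:P * 'X
  = (1 + 'X%:P) + 'X%:P * (1 + 'X) :> {poly {poly int}} by ring.
rewrite exprDn mulr_sumr !coef_sum; apply: eq_bigr => i _.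
set U : {poly {poly int}} := (1 + 'X%:P) ^+ (j + (k - i)) * (1 + 'X) ^+ (j + i).
have -> : ('X - 'X%:P) * ((1 + 'X%:P) * (1 + 'X)) ^+ j *
    ((1 + 'X%:P) ^+ (k - i) * ('X%:P * (1 + 'X)) ^+ i *+ 'C(k, i))
  = ('X * ('X%:P ^+ i * U) - 'X%:P ^+ i.+1 * U) *+ 'C(k, i).
  rewrite /U mulrnAr; congr (_ *+ _); rewrite !exprMn !exprD exprS; ring.
rewrite -!rmorphXn !coefMn coefB coefXM /= !coefCM coefB !coefXnM !coef2_prod_exp.
by rewrite -mulr_natl natz [(i < r)%N]ltnNge ltnS [(r < i)%N]ltnNge !if_neg.
Qed.

Theorem theorem5 (n k r s : nat)
  (hn : (1 <= n)%N) (hrs : (r < s)%N) (hsn : (s <= n)%N) :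
  (num_path_pairs n k r s)%:Z =
  \sum_(0 <= i < k.+1)
    binz k%:Z i%:Z *
    (binz (n%:Z - k%:Z + i%:Z - 1) (s%:Z - 1)
       * binz (n%:Z - i%:Z - 1) (n%:Z - r%:Z - 1)
     - binz (n%:Z - k%:Z + i%:Z - 1) s%:Z
       * binz (n%:Z - i%:Z - 1) (n%:Z - r%:Z)).
Proof.
have binz0 a b : ~~ ((0 <= b) && (b <= a)) -> binz a b = 0.
  by rewrite /binz => /negbTE ->.
have binzE (a b : nat) : binz a b = 'C(a, b).
  by rewrite /binz; case: (leqP b a) => [le_ba|lt_ab];
     [rewrite ifT //; lia|rewrite bin_small // ifF //; lia].
rewrite num_path_pairs_offdiag ?hrs // big_mkord.
case: n hn hsn => // n _ le_sn.
have [le_kn|lt_nk] := leqP k n; last first.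
  rewrite path_pairs_small // (ltn_eqF hrs) big1 // => i _.
  (* Each product has a vanishing factor: here i >= s > r kills the second ones; otherwise the upper
     argument of the first ones is below s - 1. *)
  have [le_ik|lt_ki] := leqP (s + k) (n.+1 + i).
    rewrite [binz _ (n.+1%:Z - r%:Z - 1)]binz0; last by lia.
    by rewrite [binz _ (n.+1%:Z - r%:Z)]binz0 ?mulr0 ?subrr ?mulr0 //; lia.
  rewrite [binz _ (s%:Z - 1)]binz0; last by lia.
  by rewrite [binz _ s%:Z]binz0 ?mul0r ?subrr ?mulr0 //; lia.
case: s hrs le_sn => // s hrs le_sn.
rewrite path_pairs_genpoly // ?coef2_genpoly; last exact: ltnW.
apply: eq_bigr => -[i /= lt_ik] _; rewrite binzE; congr (_ * _).
have -> : n.+1%:Z - k%:Z + i%:Z - 1 = (n - k + i)%N by lia.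
have -> : s.+1%:Z - 1 = s by lia.
have -> : n.+1%:Z - i%:Z - 1 = (n - i)%N by lia.
have -> : n.+1%:Z - r%:Z - 1 = (n - r)%N by lia.
have -> : n.+1%:Z - r%:Z = (n - r).+1 by lia.
have -> : (n - k + (k - i) = n - i)%N by lia.
rewrite !binzE -!PoszM; congr (_ - _).
  (* The guard on i agrees with the vanishing of the binomial, since r < i gives n - r > n - i;
     elsewhere use the symmetry of binomials. *)
  case: leqP => [le_ir|lt_ri]; last by rewrite ['C(n - i, _)]bin_small ?muln0 //; lia.
  by rewrite mulnC -['C(n - i, r - i)]bin_sub; [congr (_ * 'C(_, _))%N%:Z|]; lia.
case: ltnP => [lt_ir|le_ri]; last by rewrite ['C(n - i, _)]bin_small ?muln0 //; lia.
by rewrite mulnC -['C(n - i, r - i.+1)]bin_sub; [congr (_ * 'C(_, _))%N%:Z|]; lia.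
Qed.
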